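(* Let $(\mathcal C,p,pt)$ be a universe category, with $p:\tilde U\to U$, let $\mathcal C$ be given a locally cartesian closed structure, and let $TC$ and $FB$ be two collections of morphisms in $\mathcal C$ such that: (i) $Id_{pt}$ is in $FB$; (ii) if $B$ is such that $B\to pt$ is in $FB$, then a morphism $r:E\to B$ is in $FB$ if and only if it has the right lifting property for $TC$; (iii) if $r:E\to B$ and $B\to pt$ are in $FB$, $i:Z\to W$ is in $TC$ and $f:W\to B$ is an arbitrary morphism, then $i\times_B Id_E:(Z,i\circ f)\times_B(E,r)\to(W,f)\times_B(E,r)$ is in $TC$. Let $Eq:(\tilde U;p)\to U$ and $\Omega:\tilde U\to\tilde U$ be a J1-structure on $p$ and assume that $U$ is fibrant (i.e. $U\to pt$ is in $FB$), $p$ is in $FB$, and $\omega$ is in $TC$. Then there exists a J2-structure $Jp$ on $p$ relative to $(Eq,\Omega)$; that is, $(Eq,\Omega)$ extends to a J-structure $(Eq,\Omega,Jp)$.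
   Context: Composition is written in diagrammatic order: $f\circ g$ means first $f$, then $g$. Lifting. A morphism $r:E\to B$ has the right lifting property for $TC$ if for every $i:Z\to W$ in $TC$ and all $f_Z:Z\to E$, $f_W:W\to B$ with $f_Z\circ r=i\circ f_W$ there exists $g:W\to E$ with $i\circ g=f_Z$ and $g\circ r=f_W$. Universes. A universe in $\mathcal C$ is a morphism $p:\tilde U\to U$ together with, for every object $X$ and every $F:X\to U$, a chosen pull-back square with vertex $(X;F)$ and projections $p_{X,F}:(X;F)\to X$, $Q(F):(X;F)\to\tilde U$. A universe category $(\mathcal C,p,pt)$ is a category with a universe $p$ and a chosen final object $pt$. For $f:W\to X$, $g:W\to\tilde U$ with $f\circ F=g\circ p$, $f*g:W\to(X;F)$ is the unique morphism with $(f*g)\circ p_{X,F}=f$, $(f*g)\circ Q(F)=g$. J0- and J1-structures. A J0-structure on $p$ is a morphism $Eq:(\tilde U;p)\to U$. Put $E\tilde U:=((\tilde U;p);Eq)$ and $p_E:=p_{(\tilde U;p),Eq}\circ p_{\tilde U,p}\circ p:E\tilde U\to U$. A J1-structure over $Eq$ is a morphism $\Omega:\tilde U\to\tilde U$ with $\Omega\circ p=\Delta\circ Eq$, where $\Delta=Id_{\tilde U}*Id_{\tilde U}:\tilde U\to(\tilde U;p)$; the pair $(Eq,\Omega)$ is also called a J1-structure. Put $\omega:=\Delta*\Omega:\tilde U\to E\tilde U$ (a morphism over $U$). Locally cartesian closed structure. Chosen fiber products $(X,f)\times_Z(Y,g)$ and chosen relative internal Hom-objects $\underline{Hom}_Z((X,f),(Y,g))$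 over $Z$ (right adjoint to fiber product over $Z$ with $(X,f)$). No compatibility is assumed with the universe structure. Put $I_p(V):=\underline{Hom}_U((\tilde U,p),(U\times V,pr_1))$; for $a:V\to V'$, $I_p(a)$ is induced by $Id_U\times a$; for $h:\tilde U'\to\tilde U$ over $U$, with $p'=h\circ p$, $I^h(V):I_p(V)\to I_{p'}(V)$ is induced by pre-composition with $h$. J2-structures. Let $Fp=(I_{p_E}(U),I^{\omega}(U))\times_{I_p(U)}(I_p(\tilde U),I_p(p))$ and let $coJ:I_{p_E}(\tilde U)\to Fp$ be the morphism with components $I_{p_E}(p)$ and $I^{\omega}(\tilde U)$. A J2-structure on $p$ relative to $(Eq,\Omega)$ is a morphism $Jp:Fp\to I_{p_E}(\tilde U)$ with $Jp\circ coJ=Id_{Fp}$. A J-structure is a triple $(Eq,\Omega,Jp)$. *)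

(* Defs.v *)
Set Implicit Arguments.
Unset Strict Implicit.
Unset Printing Implicit Defensive.

Declare Scope cat_scope.
Delimit Scope cat_scope with cat.
Open Scope cat_scope.

Reserved Notation "X ~> Y" (at level 90, Y at next level).
Reserved Notation "f ;; g" (at level 50, left associativity).

(** Composition is in diagrammatic order: [f ;; g] is first [f], then [g]. *)
Record category := Category {
  ob :> Type;
  hom : ob -> ob -> Type;
  idm : forall X : ob, hom X X;
  comp : forall X Y Z : ob, hom X Y -> hom Y Z -> hom X Z;
  comp_idl : forall (X Y : ob) (f : hom X Y), comp (idm X) f = f;
  comp_idr : forall (X Y : ob) (f : hom X Y), comp f (idm Y) = f;
  comp_assoc : forall (X Y Z W : ob) (f : hom X Y) (g : hom Y Z) (h : hom Z W),
    comp (comp f g) h = comp f (comp g h) }.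

Arguments hom {c} X Y.
Arguments idm {c} X.
Arguments comp {c X Y Z} f g.
Arguments comp_idl {c X Y} f.
Arguments comp_idr {c X Y} f.
Arguments comp_assoc {c X Y Z W} f g h.

Notation "X ~> Y" := (hom X Y) : cat_scope.
Notation "f ;; g" := (comp f g) : cat_scope.

Record final_object (C : category) := FinalObject {
  pt :> C;
  to_pt : forall X : C, X ~> pt;
  to_pt_unique : forall (X : C) (f : X ~> pt), f = to_pt X }.

(** A chosen pull-back of [f] and [g]. The mediating morphism [pb_pair] is
    recorded as an operation; by [pb_unique] it is determined by the square. *)
Record pullback (C : category) (X Y Z : C) (f : X ~> Z) (g : Y ~> Z) := Pullback {
  pb_ob :> C;
  pb_fst : pb_ob ~> X;
  pb_snd : pb_ob ~> Y;
  pb_square : pb_fst ;; f = pb_snd ;; g;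
  pb_pair : forall (W : C) (a : W ~> X) (b : W ~> Y), a ;; f = b ;; g -> W ~> pb_ob;
  pb_pair_fst : forall (W : C) (a : W ~> X) (b : W ~> Y) (e : a ;; f = b ;; g),
    pb_pair e ;; pb_fst = a;
  pb_pair_snd : forall (W : C) (a : W ~> X) (b : W ~> Y) (e : a ;; f = b ;; g),
    pb_pair e ;; pb_snd = b;
  pb_unique : forall (W : C) (u v : W ~> pb_ob),
    u ;; pb_fst = v ;; pb_fst -> u ;; pb_snd = v ;; pb_snd -> u = v }.

Arguments pb_fst {C X Y Z f g} p.
Arguments pb_snd {C X Y Z f g} p.
Arguments pb_pair {C X Y Z f g} p {W a b} e.
Arguments pb_pair_fst {C X Y Z f g} p {W a b} e.
Arguments pb_pair_snd {C X Y Z f g} p {W a b} e.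

Lemma pb_map_square (C : category) (X Y X' Y' Z : C)
    (f : X ~> Z) (g : Y ~> Z) (f' : X' ~> Z) (g' : Y' ~> Z) (P : pullback f g)
    (a : X ~> X') (b : Y ~> Y') (ea : a ;; f' = f) (eb : b ;; g' = g) :
  (pb_fst P ;; a) ;; f' = (pb_snd P ;; b) ;; g'.
Proof. rewrite !comp_assoc, ea, eb; apply pb_square. Qed.

(** The morphism [a x_Z b] of pull-backs over [Z]. *)
Definition pb_map (C : category) (X Y X' Y' Z : C)
    (f : X ~> Z) (g : Y ~> Z) (f' : X' ~> Z) (g' : Y' ~> Z)
    (P : pullback f g) (P' : pullback f' g')
    (a : X ~> X') (b : Y ~> Y') (ea : a ;; f' = f) (eb : b ;; g' = g) : P ~> P' :=
  pb_pair P' (pb_map_square P ea eb).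

(** Universes. [ext F] is the chosen pull-back of [F] and [p]: its vertex is
    [(X;F)], [pb_fst] is [p_{X,F}], [pb_snd] is [Q(F)] and [pb_pair] is [f*g]. *)
Record universe (C : category) := Universe {
  tU : C;
  U : C;
  p : tU ~> U;
  ext : forall (X : C) (F : X ~> U), pullback F p }.

Arguments tU {C} u.
Arguments U {C} u.
Arguments p {C} u.
Arguments ext {C} u {X} F.

(** The relative internal Hom-object of [(X,f)] and [(Y,g)] over [Z], with respect
    to the fiber products [fp]: a universal arrow from the functor
    [(W,h) |-> (W,h) x_Z (X,f)] to [(Y,g)] in the slice category over [Z]. *)
Record internal_hom (C : category)
    (fp : forall (X Y Z : C) (f : X ~> Z) (g : Y ~> Z), pullback f g)
    (X Y Z : C) (f : X ~> Z) (g : Y ~> Z) := InternalHom {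
  ih_ob :> C;
  ih_pr : ih_ob ~> Z;
  ih_ev : fp _ _ _ ih_pr f ~> Y;
  ih_ev_over : ih_ev ;; g = pb_fst (fp _ _ _ ih_pr f) ;; ih_pr;
  ih_curry : forall (W : C) (h : W ~> Z) (a : fp _ _ _ h f ~> Y),
    a ;; g = pb_fst (fp _ _ _ h f) ;; h -> W ~> ih_ob;
  ih_curry_over : forall (W : C) (h : W ~> Z) (a : fp _ _ _ h f ~> Y)
    (e : a ;; g = pb_fst (fp _ _ _ h f) ;; h), ih_curry e ;; ih_pr = h;
  ih_curry_ev : forall (W : C) (h : W ~> Z) (a : fp _ _ _ h f ~> Y)
    (e : a ;; g = pb_fst (fp _ _ _ h f) ;; h),
    pb_map (fp _ _ _ h f) (fp _ _ _ ih_pr f) (ih_curry_over e) (comp_idl f) ;; ih_ev = a;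
  ih_unique : forall (W : C) (h : W ~> Z) (u v : W ~> ih_ob)
    (eu : u ;; ih_pr = h) (ev : v ;; ih_pr = h),
    pb_map (fp _ _ _ h f) (fp _ _ _ ih_pr f) eu (comp_idl f) ;; ih_ev
    = pb_map (fp _ _ _ h f) (fp _ _ _ ih_pr f) ev (comp_idl f) ;; ih_ev -> u = v }.

Arguments ih_pr {C fp X Y Z f g} i.
Arguments ih_ev {C fp X Y Z f g} i.
Arguments ih_ev_over {C fp X Y Z f g} i.
Arguments ih_curry {C fp X Y Z f g} i {W h a} e.
Arguments ih_curry_over {C fp X Y Z f g} i {W h a} e.
Arguments ih_curry_ev {C fp X Y Z f g} i {W h a} e.
Arguments ih_unique {C fp X Y Z f g} i {W h u v} eu ev _.

Record lcc_structure (C : category) := LccStructure {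
  fprod : forall (X Y Z : C) (f : X ~> Z) (g : Y ~> Z), pullback f g;
  ihom : forall (X Y Z : C) (f : X ~> Z) (g : Y ~> Z), internal_hom fprod f g }.

Arguments fprod {C} l {X Y Z} f g.
Arguments ihom {C} l {X Y Z} f g.

Section FunctorsI.
Context {C : category} (L : lcc_structure C) (T : final_object C).

Lemma to_pt_natural (X Y : C) (a : X ~> Y) : a ;; to_pt T Y = to_pt T X.
Proof. apply to_pt_unique. Qed.

(** Binary products are the chosen fiber products over the final object. *)
Definition bprod (X Y : C) : pullback (to_pt T X) (to_pt T Y) :=
  fprod L (to_pt T X) (to_pt T Y).

Definition bprod_map_r (X V V' : C) (a : V ~> V') : bprod X V ~> bprod X V' :=
  pb_map (bprod X V) (bprod X V') (comp_idl (to_pt T X)) (to_pt_natural a).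

(** [I_q(V)], for an arbitrary morphism [q : A -> B] (below: [p] and [p_E]). *)
Definition Ip (A B : C) (q : A ~> B) (V : C) :
    internal_hom (@fprod C L) q (pb_fst (bprod B V)) :=
  ihom L q (pb_fst (bprod B V)).

Lemma Ip_map_over (A B : C) (q : A ~> B) (V V' : C) (a : V ~> V') :
  (ih_ev (Ip q V) ;; bprod_map_r B a) ;; pb_fst (bprod B V')
  = pb_fst (fprod L (ih_pr (Ip q V)) q) ;; ih_pr (Ip q V).
Proof.
rewrite comp_assoc; unfold bprod_map_r, pb_map; rewrite pb_pair_fst, comp_idr.
apply ih_ev_over.
Qed.

(** [I_q(a)]. *)
Definition Ip_map (A B : C) (q : A ~> B) (V V' : C) (a : V ~> V') : Ip q V ~> Ip q V' :=
  ih_curry (Ip q V') (Ip_map_over q a).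

Definition Ip_pre_arg (A A' B : C) (q : A ~> B) (q' : A' ~> B) (h : A' ~> A)
    (e : h ;; q = q') (V : C) :
    fprod L (ih_pr (Ip q V)) q' ~> fprod L (ih_pr (Ip q V)) q :=
  pb_map (fprod L (ih_pr (Ip q V)) q') (fprod L (ih_pr (Ip q V)) q)
    (comp_idl (ih_pr (Ip q V))) e.

Lemma Ip_pre_over (A A' B : C) (q : A ~> B) (q' : A' ~> B) (h : A' ~> A)
    (e : h ;; q = q') (V : C) :
  (Ip_pre_arg e V ;; ih_ev (Ip q V)) ;; pb_fst (bprod B V)
  = pb_fst (fprod L (ih_pr (Ip q V)) q') ;; ih_pr (Ip q V).
Proof.
rewrite comp_assoc, ih_ev_over, <- comp_assoc.
unfold Ip_pre_arg, pb_map; rewrite pb_pair_fst, comp_idr; reflexivity.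
Qed.

(** [I^h(V) : I_q(V) -> I_q'(V)] for [h : A' -> A] with [h ;; q = q']. *)
Definition Ip_pre (A A' B : C) (q : A ~> B) (q' : A' ~> B) (h : A' ~> A)
    (e : h ;; q = q') (V : C) : Ip q V ~> Ip q' V :=
  ih_curry (Ip q' V) (Ip_pre_over e V).

Lemma pb_map_comp (X Y X' Y' X'' Y'' Z : C)
    (f : X ~> Z) (g : Y ~> Z) (f' : X' ~> Z) (g' : Y' ~> Z)
    (f'' : X'' ~> Z) (g'' : Y'' ~> Z)
    (P : pullback f g) (P' : pullback f' g') (P'' : pullback f'' g'')
    (a : X ~> X') (b : Y ~> Y') (a' : X' ~> X'') (b' : Y' ~> Y'')
    (c : X ~> X'') (d : Y ~> Y'')
    (ea : a ;; f' = f) (eb : b ;; g' = g) (ea' : a' ;; f'' = f') (eb' : b' ;; g'' = g')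
    (ec : c ;; f'' = f) (ed : d ;; g'' = g) :
  a ;; a' = c -> b ;; b' = d ->
  pb_map P P' ea eb ;; pb_map P' P'' ea' eb' = pb_map P P'' ec ed.
Proof.
intros Hc Hd; apply pb_unique; unfold pb_map; rewrite comp_assoc.
- rewrite !pb_pair_fst, <- comp_assoc, pb_pair_fst, comp_assoc, Hc; reflexivity.
- rewrite !pb_pair_snd, <- comp_assoc, pb_pair_snd, comp_assoc, Hd; reflexivity.
Qed.

Lemma Ip_map_pr (A B : C) (q : A ~> B) (V V' : C) (a : V ~> V') :
  Ip_map q a ;; ih_pr (Ip q V') = ih_pr (Ip q V).
Proof. apply ih_curry_over. Qed.

Lemma Ip_pre_pr (A A' B : C) (q : A ~> B) (q' : A' ~> B) (h : A' ~> A)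
    (e : h ;; q = q') (V : C) :
  Ip_pre e V ;; ih_pr (Ip q' V) = ih_pr (Ip q V).
Proof. apply ih_curry_over. Qed.

Lemma Ip_map_ev (A B : C) (q : A ~> B) (V V' : C) (a : V ~> V')
    (e : Ip_map q a ;; ih_pr (Ip q V') = ih_pr (Ip q V)) (e' : idm A ;; q = q) :
  pb_map (fprod L (ih_pr (Ip q V)) q) (fprod L (ih_pr (Ip q V')) q) e e'
    ;; ih_ev (Ip q V')
  = ih_ev (Ip q V) ;; bprod_map_r B a.
Proof.
etransitivity; [|exact (ih_curry_ev (Ip q V') (Ip_map_over q a))].
f_equal; apply pb_unique; unfold pb_map.
- rewrite !pb_pair_fst; reflexivity.
- rewrite !pb_pair_snd; reflexivity.
Qed.

Lemma Ip_pre_ev (A A' B : C) (q : A ~> B) (q' : A' ~> B) (h : A' ~> A)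
    (e : h ;; q = q') (V : C)
    (e1 : Ip_pre e V ;; ih_pr (Ip q' V) = ih_pr (Ip q V)) (e2 : idm A' ;; q' = q') :
  pb_map (fprod L (ih_pr (Ip q V)) q') (fprod L (ih_pr (Ip q' V)) q') e1 e2
    ;; ih_ev (Ip q' V)
  = Ip_pre_arg e V ;; ih_ev (Ip q V).
Proof.
etransitivity; [|exact (ih_curry_ev (Ip q' V) (Ip_pre_over e V))].
f_equal; apply pb_unique; unfold pb_map.
- rewrite !pb_pair_fst; reflexivity.
- rewrite !pb_pair_snd; reflexivity.
Qed.

Lemma Ip_map_pre (A A' B : C) (q : A ~> B) (q' : A' ~> B) (h : A' ~> A)
    (e : h ;; q = q') (V V' : C) (a : V ~> V') :
  Ip_map q a ;; Ip_pre e V' = Ip_pre e V ;; Ip_map q' a.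
Proof.
assert (e1 : (Ip_map q a ;; Ip_pre e V') ;; ih_pr (Ip q' V') = ih_pr (Ip q V))
  by (rewrite comp_assoc, Ip_pre_pr, Ip_map_pr; reflexivity).
assert (e2 : (Ip_pre e V ;; Ip_map q' a) ;; ih_pr (Ip q' V') = ih_pr (Ip q V))
  by (rewrite comp_assoc, Ip_map_pr, Ip_pre_pr; reflexivity).
apply (ih_unique (Ip q' V') e1 e2).
rewrite <- (pb_map_comp (fprod L (ih_pr (Ip q V)) q') (fprod L (ih_pr (Ip q V')) q')
  (fprod L (ih_pr (Ip q' V')) q') (Ip_map_pr q a) (comp_idl q')
  (Ip_pre_pr e V') (comp_idl q') e1 (comp_idl q') eq_refl (comp_idl _)).
rewrite <- (pb_map_comp (fprod L (ih_pr (Ip q V)) q') (fprod L (ih_pr (Ip q' V)) q')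
  (fprod L (ih_pr (Ip q' V')) q') (Ip_pre_pr e V) (comp_idl q')
  (Ip_map_pr q' a) (comp_idl q') e2 (comp_idl q') eq_refl (comp_idl _)).
rewrite !comp_assoc, Ip_pre_ev, Ip_map_ev, <- !comp_assoc, Ip_pre_ev.
rewrite (comp_assoc (Ip_pre_arg e V)), <- (Ip_map_ev (Ip_map_pr q a) (comp_idl q)), <- comp_assoc.
f_equal; unfold Ip_pre_arg, pb_map; apply pb_unique;
  rewrite !comp_assoc; rewrite ?pb_pair_fst, ?pb_pair_snd;
  rewrite <- !comp_assoc; rewrite ?pb_pair_fst, ?pb_pair_snd;
  rewrite !comp_assoc, ?comp_idl, ?comp_idr; reflexivity.
Qed.

End FunctorsI.

Section JStructures.
Context {C : category} (UC : universe C).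

Definition J0_structure : Type := ext UC (p UC) ~> U UC.

Definition Delta : tU UC ~> ext UC (p UC) :=
  pb_pair (ext UC (p UC)) (a := idm (tU UC)) (b := idm (tU UC)) eq_refl.

Context (Eq : J0_structure).

Definition EU : C := ext UC Eq.

Definition pE : EU ~> U UC :=
  pb_fst (ext UC Eq) ;; pb_fst (ext UC (p UC)) ;; p UC.

Record J1_structure := J1Structure {
  J1_mor :> tU UC ~> tU UC;
  J1_square : J1_mor ;; p UC = Delta ;; Eq }.

Context (Omega : J1_structure).

Definition omega : tU UC ~> EU :=
  pb_pair (ext UC Eq) (a := Delta) (b := Omega) (eq_sym (J1_square Omega)).

Lemma omega_over : omega ;; pE = p UC.
Proof.
unfold omega, pE, EU; rewrite <- !comp_assoc.
rewrite (pb_pair_fst (ext UC Eq)).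
unfold Delta; rewrite pb_pair_fst; apply comp_idl.
Qed.

Context (T : final_object C) (L : lcc_structure C).

Definition Fp : pullback (Ip_pre L T omega_over (U UC)) (Ip_map L T (p UC) (p UC)) :=
  fprod L (Ip_pre L T omega_over (U UC)) (Ip_map L T (p UC) (p UC)).

Definition coJ : Ip L T pE (tU UC) ~> Fp :=
  pb_pair Fp (a := Ip_map L T pE (p UC)) (b := Ip_pre L T omega_over (tU UC))
    (Ip_map_pre L T omega_over (p UC)).

Definition is_J2_structure (Jp : Fp ~> Ip L T pE (tU UC)) : Prop :=
  Jp ;; coJ = idm (pb_ob Fp).

End JStructures.

Arguments Fp {C UC Eq} Omega T L.
Arguments coJ {C UC Eq} Omega T L.
Arguments is_J2_structure {C UC Eq} Omega T L Jp.

Definition collection (C : category) : Type := forall X Y : C, (X ~> Y) -> Prop.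

Definition has_rlp (C : category) (TC : collection C) (E B : C) (r : E ~> B) : Prop :=
  forall (Z W : C) (i : Z ~> W), TC Z W i ->
  forall (fZ : Z ~> E) (fW : W ~> B), fZ ;; r = i ;; fW ->
  exists g : W ~> E, i ;; g = fZ /\ g ;; r = fW.

Definition fibrant (C : category) (T : final_object C) (FB : collection C) (B : C) : Prop :=
  FB B T (to_pt T B).

(* Main.v *)
Require Import Defs.

Set Implicit Arguments.
Unset Strict Implicit.
Unset Printing Implicit Defensive.

(** A section of [coJ] is a morphism from [Fp] to [Ip pE tU] whose two
    projections to [Ip pE U] and [Ip p tU] are those of [Fp].  Under the
    adjunction defining the internal Hom-objects, morphisms to [Ip q V] lying
    over [h : W ~> B] are the same as morphisms [W x_B A ~> V]
    ([Ip_curry], [Ip_uncurry]).  The two projections of [Fp] transpose to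
    morphisms [Fp x_U tU ~> tU] and [Fp x_U EU ~> U], the top and the bottom of
    a commutative square from [Fp x_U omega] to [p], and a section of [coJ] is
    the transpose of a diagonal filler of that square.

    Since [U] is fibrant, [p] lifts against [TC], so it is enough that
    [Fp x_U omega] is in [TC] up to exchanging the factors ([lifts_swap]).  As
    [omega] is in [TC], stability under fiber products with fibrations
    ([TC_fprod]) gives this once [Fp ~> U] is in [FB], and by [FB_rlp] that
    means that it has the right lifting property.  It factors as
    [Fp ~> Ip pE U ~> U].  The first morphism is a pull-back of [Ip_map p], and
    lifting [i] against that reduces to lifting [i x_U tU] against [p]
    ([Ip_map_lifts]).  Lifting [i] against the second one reduces to lifting
    [i x_U EU] against [U ~> pt] ([Ip_pr_lifts]).  Both products are in [TC]:
    [p] is in [FB] by assumption, and so is [pE], because a composite of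
    pull-backs of [p] inherits its lifting property. *)

(** * Lifting *)

Definition lifts (C : category) (Z W E B : C) (i : Z ~> W) (r : E ~> B) : Prop :=
  forall (fZ : Z ~> E) (fW : W ~> B), fZ ;; r = i ;; fW ->
  exists g : W ~> E, i ;; g = fZ /\ g ;; r = fW.

Lemma lifts_comp (C : category) (Z W E B D : C) (i : Z ~> W) (r : E ~> B) (s : B ~> D) :
  lifts i r -> lifts i s -> lifts i (r ;; s).
Proof.
intros Hr Hs fZ fW e; rewrite <- comp_assoc in e.
destruct (Hs _ _ e) as [k [k1 k2]].
destruct (Hr fZ k (eq_sym k1)) as [g [g1 g2]].
exists g; split; [exact g1 | rewrite <- comp_assoc, g2; exact k2].
Qed.

Lemma lifts_pb_fst (C : category) (Z W X Y B : C) (i : Z ~> W) (f : X ~> B) (r : Y ~> B)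
    (P : pullback f r) : lifts i r -> lifts i (pb_fst P).
Proof.
intros Hr fZ fW e.
assert (e' : (fZ ;; pb_snd P) ;; r = i ;; (fW ;; f)).
{ rewrite comp_assoc, <- pb_square, <- !comp_assoc, e; reflexivity. }
destruct (Hr _ _ e') as [k [k1 k2]].
exists (pb_pair P (eq_sym k2)); split; [|apply pb_pair_fst].
apply pb_unique; rewrite comp_assoc.
- rewrite pb_pair_fst; symmetry; exact e.
- rewrite pb_pair_snd; exact k1.
Qed.

Lemma pb_map_fst (C : category) (X Y X' Y' Z : C)
    (f : X ~> Z) (g : Y ~> Z) (f' : X' ~> Z) (g' : Y' ~> Z)
    (P : pullback f g) (P' : pullback f' g')
    (a : X ~> X') (b : Y ~> Y') (ea : a ;; f' = f) (eb : b ;; g' = g) :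
  pb_map P P' ea eb ;; pb_fst P' = pb_fst P ;; a.
Proof. apply pb_pair_fst. Qed.

Lemma pb_map_snd (C : category) (X Y X' Y' Z : C)
    (f : X ~> Z) (g : Y ~> Z) (f' : X' ~> Z) (g' : Y' ~> Z)
    (P : pullback f g) (P' : pullback f' g')
    (a : X ~> X') (b : Y ~> Y') (ea : a ;; f' = f) (eb : b ;; g' = g) :
  pb_map P P' ea eb ;; pb_snd P' = pb_snd P ;; b.
Proof. apply pb_pair_snd. Qed.

Definition pb_swap (C : category) (X Y Z : C) (f : X ~> Z) (g : Y ~> Z)
    (P : pullback f g) (Q : pullback g f) : P ~> Q :=
  pb_pair Q (eq_sym (pb_square P)).

Lemma pb_swapK (C : category) (X Y Z : C) (f : X ~> Z) (g : Y ~> Z)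
    (P : pullback f g) (Q : pullback g f) : pb_swap P Q ;; pb_swap Q P = idm (pb_ob P).
Proof.
apply pb_unique; unfold pb_swap; rewrite comp_assoc, comp_idl.
- rewrite pb_pair_fst; apply pb_pair_snd.
- rewrite pb_pair_snd; apply pb_pair_fst.
Qed.

Lemma pb_swap_map (C : category) (X Y X' Y' Z : C)
    (f : X ~> Z) (g : Y ~> Z) (f' : X' ~> Z) (g' : Y' ~> Z)
    (P : pullback f g) (P' : pullback f' g') (Q : pullback g f) (Q' : pullback g' f')
    (a : X ~> X') (b : Y ~> Y') (ea : a ;; f' = f) (eb : b ;; g' = g) :
  pb_swap P Q ;; pb_map Q Q' eb ea = pb_map P P' ea eb ;; pb_swap P' Q'.
Proof.
apply pb_unique; unfold pb_swap; rewrite !comp_assoc.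
- rewrite pb_map_fst, pb_pair_fst, pb_map_snd, <- comp_assoc, pb_pair_fst; reflexivity.
- rewrite pb_map_snd, pb_pair_snd, pb_map_fst, <- comp_assoc, pb_pair_snd; reflexivity.
Qed.

(** Exchanging the factors is an isomorphism of arrows.  This reconciles
    [TC_fprod] below, where the morphism of [TC] acts on the left factor, with
    pre-composition on internal Hom-objects, where it acts on the right one. *)
Lemma lifts_swap (C : category) (X Y X' Y' Z E B : C)
    (f : X ~> Z) (g : Y ~> Z) (f' : X' ~> Z) (g' : Y' ~> Z)
    (P : pullback f g) (P' : pullback f' g') (Q : pullback g f) (Q' : pullback g' f')
    (a : X ~> X') (b : Y ~> Y') (ea : a ;; f' = f) (eb : b ;; g' = g) (r : E ~> B) :
  lifts (pb_map P P' ea eb) r -> lifts (pb_map Q Q' eb ea) r.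
Proof.
intros H fZ fW e.
assert (e' : (pb_swap P Q ;; fZ) ;; r = pb_map P P' ea eb ;; (pb_swap P' Q' ;; fW)).
{ rewrite comp_assoc, e, <- !comp_assoc, (pb_swap_map P P' Q Q'); reflexivity. }
destruct (H _ _ e') as [k [k1 k2]].
exists (pb_swap Q' P' ;; k); split.
- rewrite <- comp_assoc, <- (pb_swap_map Q Q' P P'), comp_assoc, k1.
  rewrite <- comp_assoc, pb_swapK; apply comp_idl.
- rewrite comp_assoc, k2, <- comp_assoc, pb_swapK; apply comp_idl.
Qed.

(** * Transposition for the objects [Ip q V] *)

Section Transpose.
Context {C : category} (L : lcc_structure C) (T : final_object C).

(** The structure morphism is carried as a variable [h] with an equation, so
    that morphisms built differently over the same [h] have comparable
    transposes. *)
Definition Ip_uncurry (A B : C) (q : A ~> B) (V W : C) (h : W ~> B)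
    (u : W ~> Ip L T q V) (e : u ;; ih_pr (Ip L T q V) = h) : fprod L h q ~> V :=
  pb_map (fprod L h q) (fprod L (ih_pr (Ip L T q V)) q) e (comp_idl q)
    ;; ih_ev (Ip L T q V) ;; pb_snd (bprod L T B V).

Lemma to_pt_eq (X : C) (f g : X ~> T) : f = g.
Proof. rewrite (to_pt_unique f), (to_pt_unique g); reflexivity. Qed.

Lemma Ip_curry_over (A B : C) (q : A ~> B) (V W : C) (h : W ~> B)
    (a : fprod L h q ~> V) :
  pb_pair (bprod L T B V) (a := pb_fst (fprod L h q) ;; h) (b := a) (to_pt_eq _ _)
    ;; pb_fst (bprod L T B V) = pb_fst (fprod L h q) ;; h.
Proof. apply pb_pair_fst. Qed.

Definition Ip_curry (A B : C) (q : A ~> B) (V W : C) (h : W ~> B)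
    (a : fprod L h q ~> V) : W ~> Ip L T q V :=
  ih_curry (Ip L T q V) (Ip_curry_over a).

Lemma Ip_curry_pr (A B : C) (q : A ~> B) (V W : C) (h : W ~> B)
    (a : fprod L h q ~> V) : Ip_curry a ;; ih_pr (Ip L T q V) = h.
Proof. apply ih_curry_over. Qed.

Lemma pb_map_irrel (X Y X' Y' Z : C)
    (f : X ~> Z) (g : Y ~> Z) (f' : X' ~> Z) (g' : Y' ~> Z)
    (P : pullback f g) (P' : pullback f' g')
    (a : X ~> X') (b : Y ~> Y') (ea ea' : a ;; f' = f) (eb eb' : b ;; g' = g) :
  pb_map P P' ea eb = pb_map P P' ea' eb'.
Proof. apply pb_unique; rewrite ?pb_map_fst, ?pb_map_snd; reflexivity. Qed.

Lemma Ip_uncurry_curry (A B : C) (q : A ~> B) (V W : C) (h : W ~> B)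
    (a : fprod L h q ~> V) (e : Ip_curry a ;; ih_pr (Ip L T q V) = h) :
  Ip_uncurry e = a.
Proof.
unfold Ip_uncurry.
rewrite (pb_map_irrel _ _ e (ih_curry_over (Ip L T q V) (Ip_curry_over a)) _ (comp_idl q)).
unfold Ip_curry; rewrite ih_curry_ev; apply pb_pair_snd.
Qed.

Lemma Ip_uncurry_inj (A B : C) (q : A ~> B) (V W : C) (h : W ~> B)
    (u v : W ~> Ip L T q V) (eu : u ;; ih_pr (Ip L T q V) = h)
    (ev : v ;; ih_pr (Ip L T q V) = h) :
  Ip_uncurry eu = Ip_uncurry ev -> u = v.
Proof.
intro H; apply (ih_unique (Ip L T q V) eu ev); apply pb_unique; [|exact H].
rewrite !comp_assoc, ih_ev_over, <- !comp_assoc, !pb_map_fst, !comp_assoc, eu, ev.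
reflexivity.
Qed.

Lemma Ip_uncurry_comp (A B : C) (q : A ~> B) (V Z W : C) (h : W ~> B) (h' : Z ~> B)
    (i : Z ~> W) (ei : i ;; h = h') (u : W ~> Ip L T q V)
    (e : u ;; ih_pr (Ip L T q V) = h) (e' : (i ;; u) ;; ih_pr (Ip L T q V) = h') :
  Ip_uncurry e' = pb_map (fprod L h' q) (fprod L h q) ei (comp_idl q) ;; Ip_uncurry e.
Proof.
unfold Ip_uncurry; rewrite <- !comp_assoc.
do 2 f_equal; symmetry; apply pb_map_comp; [reflexivity | apply comp_idl].
Qed.

Lemma Ip_uncurry_map (A B : C) (q : A ~> B) (V V' W : C) (a : V ~> V') (h : W ~> B)
    (u : W ~> Ip L T q V) (e : u ;; ih_pr (Ip L T q V) = h)
    (e' : (u ;; Ip_map L T q a) ;; ih_pr (Ip L T q V') = h) :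
  Ip_uncurry e' = Ip_uncurry e ;; a.
Proof.
rewrite (Ip_uncurry_comp e (Ip_map_pr L T q a) e').
unfold Ip_uncurry; rewrite Ip_map_ev, !comp_assoc.
unfold bprod_map_r; rewrite pb_map_snd; reflexivity.
Qed.

Lemma Ip_uncurry_pre (A A' B : C) (q : A ~> B) (q' : A' ~> B) (k : A' ~> A)
    (ek : k ;; q = q') (V W : C) (h : W ~> B) (u : W ~> Ip L T q V)
    (e : u ;; ih_pr (Ip L T q V) = h)
    (e' : (u ;; Ip_pre L T ek V) ;; ih_pr (Ip L T q' V) = h) :
  Ip_uncurry e' = pb_map (fprod L h q') (fprod L h q) (comp_idl h) ek ;; Ip_uncurry e.
Proof.
rewrite (Ip_uncurry_comp e (Ip_pre_pr L T ek V) e').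
unfold Ip_uncurry; rewrite Ip_pre_ev, <- !comp_assoc.
do 2 f_equal; unfold Ip_pre_arg.
apply pb_unique; rewrite !comp_assoc, ?pb_map_fst, ?pb_map_snd, <- !comp_assoc,
  ?pb_map_fst, ?pb_map_snd, !comp_assoc, ?comp_idl, ?comp_idr; reflexivity.
Qed.

(** The usual adjunction argument: the square from [i] to [Ip_map q a]
    transposes to a square from [i x_B A] to [a], and so do its fillers. *)
Lemma Ip_map_lifts (A B : C) (q : A ~> B) (V V' Z W : C) (a : V ~> V') (i : Z ~> W) :
  (forall h : W ~> B,
     lifts (pb_map (fprod L (i ;; h) q) (fprod L h q) (eq_refl (i ;; h)) (comp_idl q)) a) ->
  lifts i (Ip_map L T q a).
Proof.
intros H fZ fW e.
set (h := fW ;; ih_pr (Ip L T q V')).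
assert (eZ : fZ ;; ih_pr (Ip L T q V) = i ;; h).
{ unfold h; rewrite <- comp_assoc, <- e, comp_assoc, Ip_map_pr; reflexivity. }
assert (eZ' : (fZ ;; Ip_map L T q a) ;; ih_pr (Ip L T q V') = i ;; h)
  by (rewrite e; apply comp_assoc).
destruct (H h (Ip_uncurry eZ) (Ip_uncurry (eq_refl h))) as [k [k1 k2]].
{ rewrite <- (Ip_uncurry_map eZ eZ').
  generalize eZ'; rewrite e; intro e'; apply Ip_uncurry_comp. }
exists (Ip_curry k); split.
- assert (e' : (i ;; Ip_curry k) ;; ih_pr (Ip L T q V) = i ;; h)
    by (rewrite comp_assoc, Ip_curry_pr; reflexivity).
  apply (Ip_uncurry_inj (eu := e') (ev := eZ)).
  rewrite (Ip_uncurry_comp (eq_refl (i ;; h)) (Ip_curry_pr k) e'), Ip_uncurry_curry.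
  exact k1.
- assert (e' : (Ip_curry k ;; Ip_map L T q a) ;; ih_pr (Ip L T q V') = h)
    by (rewrite comp_assoc, Ip_map_pr; apply Ip_curry_pr).
  apply (Ip_uncurry_inj (eu := e') (ev := eq_refl h)).
  rewrite (Ip_uncurry_map (Ip_curry_pr k) e'), Ip_uncurry_curry.
  exact k2.
Qed.

(** The bottom of a square from [i] to [Ip q V ~> B] only fixes the structure
    morphism, so what is left after transposing is an extension problem along
    [i x_B A] with values in [V]. *)
Lemma Ip_pr_lifts (A B : C) (q : A ~> B) (V Z W : C) (i : Z ~> W) :
  (forall h : W ~> B,
     lifts (pb_map (fprod L (i ;; h) q) (fprod L h q) (eq_refl (i ;; h)) (comp_idl q))
       (to_pt T V)) ->
  lifts i (ih_pr (Ip L T q V)).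
Proof.
intros H fZ h e.
destruct (H h (Ip_uncurry e) (to_pt T _) (to_pt_eq _ _)) as [k [k1 _]].
exists (Ip_curry k); split; [|apply Ip_curry_pr].
assert (e' : (i ;; Ip_curry k) ;; ih_pr (Ip L T q V) = i ;; h)
  by (rewrite comp_assoc, Ip_curry_pr; reflexivity).
apply (Ip_uncurry_inj (eu := e') (ev := e)).
rewrite (Ip_uncurry_comp (eq_refl (i ;; h)) (Ip_curry_pr k) e'), Ip_uncurry_curry.
exact k1.
Qed.

End Transpose.

(** * J2-structures as diagonal fillers *)

(** The transposes of the two projections of [Fp] form a square from
    [Fp x_U omega] to [p].  Its upper triangle says that a filler restricts to
    the second projection along [omega], its lower triangle that it lies over
    the first one. *)
Lemma J2_of_lifts (C : category) (UC : universe C) (T : final_object C)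
    (L : lcc_structure C) (Eq : J0_structure UC) (Omega : J1_structure Eq)
    (r : Fp Omega T L ~> U UC)
    (er : pb_fst (Fp Omega T L) ;; ih_pr (Ip L T (pE Eq) (U UC)) = r) :
  lifts (pb_map (fprod L r (p UC)) (fprod L r (pE Eq)) (comp_idl r) (omega_over Omega))
    (p UC) ->
  exists Jp : Fp Omega T L ~> Ip L T (pE Eq) (tU UC), is_J2_structure Omega T L Jp.
Proof.
intro H.
pose proof (pb_square (Fp Omega T L)) as sq.
assert (es : pb_snd (Fp Omega T L) ;; ih_pr (Ip L T (p UC) (tU UC)) = r).
{ rewrite <- (Ip_map_pr L T (p UC) (p UC)), <- comp_assoc, <- sq, comp_assoc, Ip_pre_pr.
  exact er. }
destruct (H (Ip_uncurry es) (Ip_uncurry er)) as [k [k1 k2]].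
{ assert (e1 : (pb_snd (Fp Omega T L) ;; Ip_map L T (p UC) (p UC)) ;; ih_pr _ = r)
    by (rewrite comp_assoc, Ip_map_pr; exact es).
  rewrite <- (Ip_uncurry_map es e1); revert e1; rewrite <- sq; intro e1.
  apply Ip_uncurry_pre. }
exists (Ip_curry T k); unfold is_J2_structure, coJ.
apply pb_unique; rewrite comp_assoc, comp_idl.
- rewrite pb_pair_fst.
  assert (e : (Ip_curry T k ;; Ip_map L T (pE Eq) (p UC)) ;; ih_pr _ = r)
    by (rewrite comp_assoc, Ip_map_pr; apply Ip_curry_pr).
  apply (Ip_uncurry_inj (eu := e) (ev := er)).
  rewrite (Ip_uncurry_map (Ip_curry_pr T k) e), Ip_uncurry_curry.
  exact k2.
- rewrite pb_pair_snd.
  assert (e : (Ip_curry T k ;; Ip_pre L T (omega_over Omega) (tU UC)) ;; ih_pr _ = r)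
    by (rewrite comp_assoc, Ip_pre_pr; apply Ip_curry_pr).
  apply (Ip_uncurry_inj (eu := e) (ev := es)).
  rewrite (Ip_uncurry_pre (Ip_curry_pr T k) e), Ip_uncurry_curry.
  exact k1.
Qed.

Theorem theorem2p3p8
  (C : category) (UC : universe C) (T : final_object C) (L : lcc_structure C)
  (TC FB : collection C)
  (FB_pt : FB T T (idm (pt T)))
  (FB_rlp : forall B : C, fibrant T FB B ->
     forall (E : C) (r : E ~> B), FB E B r <-> has_rlp TC r)
  (TC_fprod : forall (E B Z W : C) (r : E ~> B) (i : Z ~> W) (f : W ~> B),
     FB E B r -> fibrant T FB B -> TC Z W i ->
     TC (fprod L (i ;; f) r) (fprod L f r)
        (pb_map (fprod L (i ;; f) r) (fprod L f r) (eq_refl (i ;; f)) (comp_idl r)))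
  (Eq : J0_structure UC) (Omega : J1_structure Eq)
  (U_fibrant : fibrant T FB (U UC))
  (p_FB : FB (tU UC) (U UC) (p UC))
  (omega_TC : TC (tU UC) (EU Eq) (omega Omega)) :
  exists Jp : Fp Omega T L ~> Ip L T (pE Eq) (tU UC), is_J2_structure Omega T L Jp.
Proof.
assert (p_lifts : forall (Z W : C) (i : Z ~> W), TC Z W i -> lifts i (p UC))
  by exact (proj1 (FB_rlp (U UC) U_fibrant _ _) p_FB).
assert (pt_fibrant : fibrant T FB T).
{ unfold fibrant; rewrite <- (to_pt_unique (idm (pt T))); exact FB_pt. }
assert (U_lifts : forall (Z W : C) (i : Z ~> W), TC Z W i -> lifts i (to_pt T (U UC)))
  by exact (proj1 (FB_rlp T pt_fibrant _ _) U_fibrant).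
assert (pE_FB : FB (EU Eq) (U UC) (pE Eq)).
{ apply (FB_rlp (U UC) U_fibrant); intros Z W i Hi; unfold pE, EU.
  apply lifts_comp; [apply lifts_comp|]; [apply lifts_pb_fst | apply lifts_pb_fst |];
    exact (p_lifts Z W i Hi). }
set (r := pb_fst (Fp Omega T L) ;; ih_pr (Ip L T (pE Eq) (U UC))).
assert (r_FB : FB (Fp Omega T L) (U UC) r).
{ apply (FB_rlp (U UC) U_fibrant); intros Z W i Hi; unfold r.
  apply lifts_comp.
  - apply lifts_pb_fst, Ip_map_lifts; intro h; apply p_lifts, TC_fprod; assumption.
  - apply Ip_pr_lifts; intro h; apply U_lifts, TC_fprod; assumption. }
(* [TC_fprod] has [omega ;; pE] as the structure morphism of the source, where
   [p] is wanted: the two are equal but not convertible. *)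
assert (omega_r_TC : forall (q : tU UC ~> U UC) (e : omega Omega ;; pE Eq = q),
  TC _ _ (pb_map (fprod L q r) (fprod L (pE Eq) r) e (comp_idl r)))
  by (intros q e; destruct e; apply TC_fprod; assumption).
apply (J2_of_lifts (r := r) eq_refl).
apply (lifts_swap (P := fprod L (p UC) r) (P' := fprod L (pE Eq) r)).
apply p_lifts, omega_r_TC.
Qed.
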